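(* (i) If $v=2k\geq4$, then $\mathrm{A}_q(v,v-1)=\mathrm{A}_q(v,v;k)=q^k+1$. Every $(v,q^k+1,v-1)_q$ subspace code contains, besides $k$-dimensional subspaces, at most one subspace of dimension $k-1$, at most one of dimension $k+1$, and none of any other dimension; the dimension distributions realized by such codes are exactly $(\delta_{k-1},\delta_k,\delta_{k+1})\in\{(0,q^k+1,0),(1,q^k,0),(0,q^k,1),(1,q^k-1,1)\}$ (with $\delta_t=0$ otherwise). (ii) If $v=2k+1\geq5$, then $\mathrm{A}_q(v,v-1)=\mathrm{A}_q(v,v-1;k)=q^{k+1}+1$, and the dimension distributions realized by $(v,q^{k+1}+1,v-1)_q$ subspace codes are exactly those with $(\delta_{k-1},\delta_k,\delta_{k+1},\delta_{k+2})$ equal to one of $(0,q^{k+1}+1,0,0)$, $(0,0,q^{k+1}+1,0)$, $(0,q^{k+1},1,0)$, $(0,1,q^{k+1},0)$, $(0,q^{k+1},0,1)$, $(1,0,q^{k+1},0)$ and $\delta_t=0$ for all other $t$.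
   Context: $\mathrm{d}_{\mathrm{S}}(X,Y)=\dim(X+Y)-\dim(X\cap Y)$. A $(v,M,d)_q$ subspace code is a set of $M$ subspaces of a $v$-dimensional $\mathbb{F}_q$-space with minimum pairwise subspace distance $d$. $\mathrm{A}_q(v,d)$ is the maximum size of a set of subspaces of $\mathbb{F}_q^v$ with pairwise distance $\ge d$; $\mathrm{A}_q(v,d;k)$ the same restricted to $k$-dimensional subspaces. The dimension distribution of a code $\mathcal{C}$ is $(\delta_0,\dots,\delta_v)$ with $\delta_t$ the number of codewords of dimension $t$.
   Formalization: A (v,M,d)_q code is read as having minimum distance at least d; with minimum distance exactly v−1 the distribution (0,q^k+1,0) in (i) could not occur, since distances between k-dimensional subspaces are even while v−1 is odd. *)

(* Defs.v *)
From HB Require Import structures.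
From mathcomp Require Import all_boot all_order all_algebra all_fingroup all_field.
Set Implicit Arguments. Unset Strict Implicit. Unset Printing Implicit Defensive.
Import GRing.Theory.
Local Open Scope ring_scope.

Notation subsp F v := {vspace 'rV[F]_v}.

Definition subspace_dist (F : fieldType) (v : nat) (X Y : subsp F v) : nat :=
  (\dim (X + Y)%VS - \dim (X :&: Y)%VS)%N.

Definition is_code (F : fieldType) (v d : nat) (C : seq (subsp F v)) : Prop :=
  uniq C /\ forall X Y, X \in C -> Y \in C -> X != Y -> (d <= subspace_dist X Y)%N.

Definition is_cdc (F : fieldType) (v d k : nat) (C : seq (subsp F v)) : Prop :=
  is_code d C /\ forall X, X \in C -> \dim X = k.

Definition isAq (F : finFieldType) (v d N : nat) : Prop :=
  (exists C : seq (subsp F v), is_code d C /\ size C = N) /\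
  (forall C : seq (subsp F v), is_code d C -> (size C <= N)%N).

Definition isAqk (F : finFieldType) (v d k N : nat) : Prop :=
  (exists C : seq (subsp F v), is_cdc d k C /\ size C = N) /\
  (forall C : seq (subsp F v), is_cdc d k C -> (size C <= N)%N).

Definition dimdist (F : fieldType) (v : nat) (C : seq (subsp F v)) (t : nat) : nat :=
  count (fun X : subsp F v => \dim X == t) C.

(* Main.v *)
(* For two subspaces at distance at least [v - 1], the dimension of the
   intersection and the codimension of the sum add up to at most one; so the sum
   of their dimensions is close to [v], and a code with three or more elements
   lives in the middle dimensions. Passing to orthogonal spaces preserves codes,
   and a family with trivial intersections packs the nonzero vectors of
   any subspace, or the vectors outside it; comparing the counts bounds the
   layers when [v] is even. When [v = 2k + 1], a partial [k]-spread is bounded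
   by averaging its packing over all hyperplanes, and a code with [n] elements
   of dimension [k] and [m] of dimension [k + 1] is handled by the quadratic
   count [(q - 1) (m - q - 1) (m - Q) >= e (q + 1) (Q - q)], with [Q = q^(k+1)]
   and [e = n + m - Q - 1], together with its dual. Extremal codes come from
   the graphs of multiplications of the field of order [q^N] together with the
   vertical space, one or two of whose members may be shrunk or enlarged, and
   from the duals of such codes. *)
Require Import Defs.
From HB Require Import structures.
From mathcomp Require Import all_boot all_order all_algebra all_fingroup all_field.
From mathcomp Require Import zify.

Set Implicit Arguments.
Unset Strict Implicit.
Unset Printing Implicit Defensive.

(** * Finite fields: an extension of every degree *)

Section FieldExtension.
Local Open Scope ring_scope.
Import GRing.Theory.

(* As in [pPrimePowerField], but over an arbitrary finite base field: the
   splitting field of ['X^(q ^ n) - 'X] consists of the roots alone. *)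
Lemma finField_ext_exists (F : finFieldType) (n : nat) :
  (0 < n)%N -> exists L : fieldExtType F, \dim {:L} = n.
Proof.
move=> n_gt0; pose m := (#|F| ^ n)%N.
have F_gt1 := finNzRing_gt1 F.
have m_gt1: (1 < m)%N by rewrite (ltn_exp2l 0).
have m_gt0 := ltnW m_gt1; have m1_gt0: (0 < m.-1)%N by rewrite -ltnS prednK.
pose q (R : nzRingType) : {poly R} := 'X^m - 'X.
have Dq R: q R = ('X^(m.-1) - 1) * ('X - 0).
  by rewrite subr0 mulrBl mul1r -exprSr prednK.
have /FinSplittingFieldFor[/= L splitLq]: q F != 0.
  by rewrite Dq monic_neq0 ?rpredM ?monicXsubC ?monicXnsubC.
rewrite [map_poly _ _]rmorphB /= map_polyXn /= map_polyX -/(q L) in splitLq.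
have /finField_galois_generator[/= a _ Da]: (1 <= {:L})%VS by apply: sub1v.
pose Em := fixedSpace (a ^+ n)%g; rewrite dimv1 expn1 in Da.
have{splitLq} [zs DqL defL] := splitLq.
have [p p_pr pcharF] := finPcharP F.
have pcharL: p \in [pchar L] by rewrite pchar_lalg.
(* In [L] the number [m.-1] thus becomes [-1], which is nonzero, so ['X^(m.-1) - 1] is separable. *)
have m0: m%:R = 0 :> L.
  have F0: #|F|%:R = 0 :> L.
    have [e De]: exists e, #|F| = (p ^ e)%N.
      by exists (logn p #|F|); exact: (card_pprimeChar pcharF).
    move: F_gt1; rewrite De natrX (pcharf0 pcharL).
    by case: e {De} => [|e _]; rewrite ?expn0 ?ltnn ?expr0n.
  by rewrite natrX F0 expr0n gtn_eqF.
have Uzs: uniq zs.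
  rewrite -separable_prod_XsubC -(eqp_separable DqL) Dq separable_root andbC.
  rewrite /root !hornerE subr_eq0 eq_sym expr0n gtn_eqF ?oner_eq0 //=.
  rewrite cyclotomic.separable_Xn_sub_1 // -subn1 natrB // subr_eq0 m0.
  by rewrite eq_sym oner_eq0.
(* [a] raises to the power [#|F|], so the roots are the fixed points of its [n]-th power. These form
   a subfield, which is all of [L] because the roots generate it. *)
have in_zs: zs =i Em.
  move=> z; rewrite -root_prod_XsubC -(eqp_root DqL) (sameP fixedSpaceP eqP).
  rewrite /root !hornerE subr_eq0 /= /m; congr (_ == z).
  elim: (n) => [|i IHi]; first by rewrite gal_id.
  by rewrite expgSr expnSr exprM IHi galM ?Da ?memvf.
have defEm: Em = {:L}%VS.
  apply/eqP; rewrite eqEsubv subvf -defL -[Em]subfield_closed agenvS //.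
  by rewrite subv_add sub1v; apply/span_subvP=> z; rewrite in_zs.
(* Two counts of [L]: a power of [#|F|] given by the dimension, and the number [m] of roots. *)
exists L; apply: (expnI F_gt1).
have <- := @card_vspace F (finvect_type L) _ {:L}.
have /eq_card->: ({:L}%VS : {vspace finvect_type L}) =i zs.
  by move=> z; rewrite in_zs defEm.
apply: succn_inj; rewrite (card_uniqP _) //= -(size_prod_XsubC _ id).
by rewrite -(eqp_size DqL) size_polyDl size_polyXn // size_polyN size_polyX.
Qed.

End FieldExtension.

(* [\dim] of a row space has type [nat] only up to unfolding, and its ambient
   space may or may not be wrapped in [reverse_coercion]; [lia] needs both
   normalised. *)
Ltac dlia :=
  unfold reverse_coercion in *;
  repeat match goal with
  | H : @eq (Algebra.BaseAddUMagma.sort _) ?a ?b |- _ =>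
      change (@eq nat a b) in H
  | |- @eq (Algebra.BaseAddUMagma.sort _) ?a ?b => change (@eq nat a b)
  end;
  lia.

(** * Orthogonal spaces, subspace distance and double counting *)

Section Subspaces.
Local Open Scope ring_scope.
Import GRing.Theory.
Variables (F : finFieldType) (v : nat).
Implicit Types X Y W : subsp F v.

Lemma dim_fullrV (n : nat) : \dim {: 'rV[F]_n} = n.
Proof. by rewrite dimvf /dim /= mul1n. Qed.

Lemma dim_subsp_le X : (\dim X <= v)%N.
Proof. by rewrite -[leqRHS]dim_fullrV dimvS ?subvf. Qed.

Lemma card_subsp X : #|X| = (#|F| ^ \dim X)%N.
Proof. exact: card_vspace. Qed.

Lemma card_set_subsp X : #|[set x in X]| = (#|F| ^ \dim X)%N.
Proof. by rewrite cardsE card_subsp. Qed.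

Definition basis_mx X : 'M[F]_(\dim X, v) := \matrix_i (vbasis X)`_i.

Lemma basis_mx_free X : row_free (basis_mx X).
Proof.
apply: inj_row_free => u; rewrite mulmx_sum_row => u0; apply/rowP=> i.
have /freeP fX := basis_free (vbasisP X); rewrite mxE; apply: fX.
by rewrite -[RHS]u0; apply: eq_bigr => j _; rewrite rowK.
Qed.

Definition basis_lfun X : 'Hom('rV[F]_v, 'rV[F]_(\dim X)) :=
  linfun (mulmxr (basis_mx X)^T).

(** The orthogonal space for the standard dot product, encoded as a kernel so that rank-nullity
    gives its dimension. *)
Definition dual X : subsp F v := lker (basis_lfun X).

Lemma memv_dual X (y : 'rV[F]_v) :
  reflect (forall x, x \in X -> y *m x^T = 0) (y \in dual X).
Proof.
rewrite memv_ker lfunE /=; apply: (iffP eqP) => [y0 x Xx | y0].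
  have ->: x = (\row_i coord (vbasis X) i x) *m basis_mx X.
    rewrite [LHS](coord_vbasis Xx) mulmx_sum_row.
    by apply: eq_bigr => i _; rewrite mxE rowK.
  by rewrite trmx_mul mulmxA y0 mul0mx.
apply/rowP=> i; rewrite [RHS]mxE.
have <-: (y *m ((vbasis X)`_i)^T) 0 0 = (y *m (basis_mx X)^T) 0 i.
  by rewrite !mxE; apply: eq_bigr => j _; rewrite !mxE.
by rewrite y0 ?mxE // vbasis_mem ?mem_nth // size_tuple.
Qed.

Lemma dim_dual X : \dim (dual X) = (v - \dim X)%N.
Proof.
have /row_freeP[D BD] := basis_mx_free X.
have := limg_ker_dim (basis_lfun X) fullv.
have -> : (fullv :&: lker (basis_lfun X))%VS = dual X.
  by apply/vspaceP=> x; rewrite memv_cap memvf.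
have -> : limg (basis_lfun X) = fullv.
  apply/vspaceP=> z; rewrite memvf; apply/memv_imgP; exists (z *m D^T).
    exact: memvf.
  by rewrite lfunE /= -mulmxA -trmx_mul BD trmx1 mulmx1.
by rewrite !dim_fullrV; dlia.
Qed.

Lemma dualS X Y : (X <= Y)%VS -> (dual Y <= dual X)%VS.
Proof.
move=> /subvP sXY; apply/subvP=> y /memv_dual Yy.
by apply/memv_dual=> x /sXY; apply: Yy.
Qed.

(** Symmetry of the dot product gives one inclusion, and equal dimensions do the rest. *)
Lemma dualK : involutive dual.
Proof.
move=> X; apply/esym/eqP; rewrite eqEdim; apply/andP; split.
  apply/subvP=> x Xx; apply/memv_dual=> y /memv_dual/(_ x Xx) yx.
  by apply: trmx_inj; rewrite trmx_mul trmxK trmx0.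
by rewrite !dim_dual subKn ?dim_subsp_le.
Qed.

Lemma dual_sub X Y : (X <= dual Y)%VS = (Y <= dual X)%VS.
Proof. by apply/idP/idP => /dualS; rewrite dualK. Qed.

Lemma dual_cap X Y : (dual X :&: dual Y)%VS = dual (X + Y).
Proof.
apply/eqP; rewrite eqEsubv subv_cap !dualS ?addvSl ?addvSr // andbT.
by rewrite dual_sub subv_add (dual_sub X) (dual_sub Y) capvSl capvSr.
Qed.

Lemma dim_dual_cap X Y :
  (\dim (dual X :&: dual Y) + \dim X + \dim Y = v + \dim (X :&: Y))%N.
Proof.
rewrite dual_cap dim_dual.
by have := dimv_sum_cap X Y; have := dim_subsp_le (X + Y)%VS; dlia.
Qed.

(** The dimension formula eliminates the sum; the additive form avoids truncated subtraction. *)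
Lemma subspace_distE X Y :
  (subspace_dist X Y + (\dim (X :&: Y)).*2 = \dim X + \dim Y)%N.
Proof.
have le_cap : (\dim (X :&: Y) <= \dim (X + Y))%N.
  by rewrite dimvS // (subv_trans (capvSl _ _)) ?addvSl.
by rewrite /subspace_dist; have := dimv_sum_cap X Y; dlia.
Qed.

(** Orthogonality exchanges sum and intersection and complements their dimensions in [v]. *)
Lemma subspace_dist_dual X Y :
  subspace_dist (dual X) (dual Y) = subspace_dist X Y.
Proof.
have := subspace_distE X Y; have := subspace_distE (dual X) (dual Y).
rewrite !dim_dual; have := dim_dual_cap X Y.
by have := dim_subsp_le X; have := dim_subsp_le Y; dlia.
Qed.

Lemma dual_code d (C : seq (subsp F v)) :
  is_code d C -> is_code d [seq dual X | X <- C].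
Proof.
case=> uC dC; split; first by rewrite (map_inj_uniq (can_inj dualK)).
move=> _ _ /mapP[X CX ->] /mapP[Y CY ->] neq.
rewrite subspace_dist_dual; apply: dC => //.
by apply: contraNneq neq => ->.
Qed.

(** For [t > v] the truncated [v - t] would wrongly count the zero space. *)
Lemma dimdist_dual (C : seq (subsp F v)) t : (t <= v)%N ->
  dimdist [seq dual X | X <- C] t = dimdist C (v - t)%N.
Proof.
move=> le_tv; rewrite /dimdist count_map; apply: eq_count => X /=.
by rewrite dim_dual; have := dim_subsp_le X; dlia.
Qed.

(** Double counting of incident pairs of a vector and a space. The weight is later [1], or again an
    incidence count, which yields a second moment. *)
Lemma sum_count_weight (s : seq (subsp F v)) (T : {set 'rV[F]_v})
    (f : 'rV[F]_v -> nat) :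
  (\sum_(x in T) count (fun X : subsp F v => x \in X) s * f x =
     \sum_(X <- s) \sum_(x in T :&: [set x in X]) f x)%N.
Proof.
elim: s => [|X s IHs]; first by rewrite big_nil big1.
rewrite big_cons -IHs big_mkcond [X in (X + _)%N]big_mkcond /=.
rewrite [X in (_ + X)%N]big_mkcond -big_split /=; apply: eq_bigr => x _.
by rewrite !inE; case: (x \in T); case: (x \in X); rewrite ?mulnDl ?mul1n.
Qed.

Lemma sum_count_card (s : seq (subsp F v)) (T : {set 'rV[F]_v}) :
  (\sum_(x in T) count (fun X : subsp F v => x \in X) s =
     \sum_(X <- s) #|T :&: [set x in X]|)%N.
Proof.
under eq_bigr do rewrite -[count _ _]muln1.
rewrite (sum_count_weight _ _ (fun=> 1%N)).
by apply: eq_bigr => X _; rewrite sum1_card.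
Qed.

Definition nz_set X : {set 'rV[F]_v} := [set x in X] :\ 0.

Lemma card_nz_set X : #|nz_set X| = (#|F| ^ \dim X).-1.
Proof.
have := cardsD1 0 [set x in X]; rewrite inE mem0v /= cardsE card_subsp => ->.
by [].
Qed.

Lemma nz_setI X Y : nz_set X :&: [set x in Y] = nz_set (X :&: Y).
Proof. by apply/setP=> x; rewrite !inE memv_cap andbA. Qed.

End Subspaces.

(** * Partial spreads from multiplication in a field *)

Section PartialSpread.
Local Open Scope ring_scope.
Import GRing.Theory.

Section Comb.
Variables (F : finFieldType) (v : nat) (L : vectType F).

Definition comb (e : nat -> L) (x : 'rV[F]_v) : L := \sum_i x 0 i *: e i.

Lemma comb_linear e : linear (comb e).
Proof.
move=> a x y; rewrite /comb scaler_sumr -big_split /=; apply: eq_bigr => i _.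
by rewrite !mxE scalerDl scalerA.
Qed.
HB.instance Definition _ e :=
  GRing.isLinear.Build F 'rV[F]_v L *:%R (comb e) (comb_linear e).

Lemma memv_ker_comb e x : (x \in lker (linfun (comb e))) = (comb e x == 0).
Proof. by rewrite memv_ker lfunE. Qed.

Lemma dim_lker_ge (f : 'Hom('rV[F]_v, L)) d :
  (\dim (limg f) <= d)%N -> (v - d <= \dim (lker f))%N.
Proof.
have := limg_ker_dim f fullv.
have -> : (fullv :&: lker f)%VS = lker f.
  by apply/vspaceP=> x; rewrite memv_cap memvf.
by rewrite dim_fullrV; dlia.
Qed.

End Comb.

(* With [L] the field of order [q ^ N], [F^v] embeds in [L * L] by a pair of
   linear maps [(g, h)] where [g] has rank at most [k]; the members of the
   partial spread are [h = a * g] for [a] in [L], and [U] is [g = 0]. *)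
Lemma partial_spread_exists (F : finFieldType) (v k N : nat) :
    v = (k + N)%N -> (0 < k)%N -> (k <= N)%N ->
  exists (U : subsp F v) (s : seq (subsp F v)),
    [/\ \dim U = N, uniq s, size s = (#|F| ^ N)%N &
        (forall X, X \in s -> \dim X = k /\ (X :&: U = 0)%VS)
        /\ (forall X Y, X \in s -> Y \in s -> X != Y -> (X :&: Y = 0)%VS)].
Proof.
move=> Dv k_gt0 le_kN.
have [L dimL] := finField_ext_exists F (leq_trans k_gt0 le_kN).
pose b := vbasis {:L}; have free_b : free b := basis_free (vbasisP _).
(* [eg] uses the first [k] coordinates and [k] basis vectors, [eh] the other [N] coordinates and the
   whole basis; the pair is therefore injective. *)
pose eg i := if (i < k)%N then b`_i else 0.
pose eh i := if (k <= i)%N then b`_(i - k) else 0.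
pose X a : subsp F v := lker (linfun (comb (fun i => eh i - a * eg i))).
pose U : subsp F v := lker (linfun (comb eg)).
have combX a (x : 'rV[F]_v) :
    comb (fun i => eh i - a * eg i) x = comb eh x - a * comb eg x.
  rewrite /comb mulr_sumr -sumrB; apply: eq_bigr => i _.
  by rewrite scalerBr scalerAr.
have inX a x : x \in X a -> comb eh x = a * comb eg x.
  by rewrite memv_ker_comb combX subr_eq0 => /eqP.
have inj_gh (x : 'rV[F]_v) : comb eg x = 0 -> comb eh x = 0 -> x = 0.
  move=> g0 h0; apply/rowP=> i; rewrite [RHS]mxE.
  have [lt_ik | le_ki] := ltnP i k.
    have lt_iL : (i < \dim {:L})%N by rewrite dimL (leq_trans lt_ik).
    have := congr1 (coord b (Ordinal lt_iL)) g0.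
    rewrite linear0 linear_sum (bigD1 i) //= linearZ /= /eg lt_ik.
    rewrite (coord_free (Ordinal lt_iL) (Ordinal lt_iL)) // eqxx mulr1.
    rewrite big1 ?addr0 // => j ne_ji; rewrite linearZ /=.
    case: ifP => [lt_jk | _]; last by rewrite linear0 mulr0.
    have lt_jL : (j < \dim {:L})%N by rewrite dimL (leq_trans lt_jk).
    rewrite (coord_free (Ordinal lt_jL) (Ordinal lt_iL)) // -val_eqE /=.
    by move: ne_ji; rewrite -val_eqE => /negPf ->; rewrite mulr0.
  have lt_iL : (i - k < \dim {:L})%N.
    by rewrite dimL; have := ltn_ord i; dlia.
  have := congr1 (coord b (Ordinal lt_iL)) h0.
  rewrite linear0 linear_sum (bigD1 i) //= linearZ /= /eh le_ki.
  rewrite (coord_free (Ordinal lt_iL) (Ordinal lt_iL)) // eqxx mulr1.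
  rewrite big1 ?addr0 // => j ne_ji; rewrite linearZ /=.
  case: ifP => [le_kj | _]; last by rewrite linear0 mulr0.
  have lt_jL : (j - k < \dim {:L})%N.
    by rewrite dimL; have := ltn_ord j; dlia.
  rewrite (coord_free (Ordinal lt_jL) (Ordinal lt_iL)) // -val_eqE /=.
  rewrite (_ : (j - k == i - k)%N = false) ?mulr0 //.
  apply/negbTE; apply: contraNneq ne_ji => E; apply/eqP/val_inj => /=.
  by move: le_ki le_kj; dlia.
have XU a : (X a :&: U = 0)%VS.
  apply/eqP; rewrite -subv0; apply/subvP=> x.
  rewrite memv_cap memv0 => /andP[/inX Xx]; rewrite memv_ker_comb => /eqP g0.
  by apply/eqP/inj_gh; rewrite // Xx g0 mulr0.
have XX a c : a != c -> (X a :&: X c = 0)%VS.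
  move=> ne_ac; apply/eqP; rewrite -subv0; apply/subvP=> x.
  rewrite memv_cap memv0 => /andP[/inX Xx /inX Yx].
  have /eqP: (a - c) * comb eg x = 0 by rewrite mulrBl -Xx -Yx subrr.
  rewrite mulf_eq0 subr_eq0 (negPf ne_ac) => /eqP g0.
  by apply/eqP/inj_gh; rewrite // Xx g0 mulr0.
have dimU : (N <= \dim U)%N.
  have -> : N = (v - k)%N by rewrite Dv addKn.
  apply: dim_lker_ge.
    apply: (@leq_trans (size (take k b))); last by rewrite size_take; case: ltnP.
    apply: leq_trans (dim_span _); apply: dimvS; apply/subvP=> y.
    case/memv_imgP=> x _ ->; rewrite lfunE /=; apply: memv_suml => i _.
    apply: memvZ; rewrite /eg; case: ifP => [lt_ik | _]; last exact: mem0v.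
    rewrite -(nth_take _ lt_ik) memv_span // mem_nth //.
    by rewrite size_take size_tuple dimL; case: (ltnP k N) => _ //;
      apply: leq_trans le_kN.
have dimX a : (k <= \dim (X a))%N.
  have -> : k = (v - N)%N by rewrite Dv addnK.
  by apply: dim_lker_ge; rewrite -dimL dimvS ?subvf.
(* The lower bounds [k] and [N] add up to [v], so this upper bound makes both exact. *)
have dims a : (\dim (X a) + \dim U <= v)%N.
  by rewrite -dimv_disjoint_sum ?XU // dim_subsp_le.
have dimXk a : \dim (X a) = k.
  by have := dimX a; have := dims a; dlia.
pose XL (a : finvect_type L) := X a.
(* A space given by two multipliers would be its own intersection, hence zero, against [0 < k]. *)
have inj_XL : injective XL.
  move=> a c eqX; apply/eqP; apply: contraTT k_gt0 => /XX.
  by rewrite -/(XL a) -/(XL c) eqX capvv -(dimXk c) => X0;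
    rewrite -/(XL c) X0 dimv0.
exists U, [seq XL a | a <- enum (finvect_type L)]; split.
- by have := dimX 0; have := dims 0; dlia.
- by rewrite (map_inj_uniq inj_XL) enum_uniq.
- rewrite size_map -cardE -dimL -(@card_vspace F (finvect_type L) _ {:L}).
  by apply/esym/eq_card => x; rewrite memvf.
split=> [_ /mapP[a _ ->] // | _ _ /mapP[a _ ->] /mapP[c _ ->] ne].
by apply: XX; apply: contraNneq ne; rewrite /XL => ->.
Qed.

End PartialSpread.

(** * Codes built from a partial spread and one or two modified members *)

Section Constructions.
Variables (F : finFieldType) (v : nat).
Implicit Types (X Y W U : subsp F v) (C s : seq (subsp F v)).

Lemma sub_subspace_exists U n : (n <= \dim U)%N ->
  exists2 W, (W <= U)%VS & \dim W = n.
Proof.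
move=> le_nU; exists <<take n (vbasis U)>>%VS.
  by apply/span_subvP=> x /mem_take /vbasis_mem.
have free_take : free (take n (vbasis U)).
  have := basis_free (vbasisP U).
  by rewrite -{1}(cat_take_drop n (vbasis U)); apply: catl_free.
by rewrite (eqP free_take) size_takel ?size_tuple.
Qed.

Lemma super_subspace_exists U n : (\dim U <= n <= v)%N ->
  exists2 W, (U <= W)%VS & \dim W = n.
Proof.
move=> /andP[le_Un le_nv].
have [|W sWU dimW] := @sub_subspace_exists (dual U) (v - n).
  by rewrite dim_dual leq_sub2l.
by exists (dual W); rewrite ?dim_dual ?dimW ?subKn // dual_sub.
Qed.

(** As [W] is at distance [0] from itself, [0 < d] keeps it out of [C]. *)
Lemma code_cons d W C : (0 < d)%N -> is_code d C ->
  (forall X, X \in C -> (d <= subspace_dist W X)%N) -> is_code d (W :: C).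
Proof.
move=> d_gt0 [uC dC] dW; split=> [|X Y].
  rewrite cons_uniq uC andbT; apply/negP=> /dW.
  by have := subspace_distE W W; rewrite capvv; dlia.
rewrite !inE => /predU1P[->|CX] /predU1P[->|CY] neq.
- by rewrite eqxx in neq.
- exact: dW.
- by rewrite /subspace_dist addvC capvC; apply: dW.
exact: dC.
Qed.

Lemma code_disjoint k s : uniq s -> (forall X, X \in s -> \dim X = k) ->
  (forall X Y, X \in s -> Y \in s -> X != Y -> (X :&: Y = 0)%VS) ->
  is_code k.*2 s.
Proof.
move=> us dims djs; split=> // X Y sX sY neq.
have := subspace_distE X Y; rewrite djs // dimv0 !dims //; dlia.
Qed.

Lemma code_le d d' C : (d' <= d)%N -> is_code d C -> is_code d' C.
Proof.
move=> le_d [uC dC]; split=> // X Y CX CY /dC dXY.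
by rewrite (leq_trans le_d) ?dXY.
Qed.

Lemma dimdist_cons W C t : dimdist (W :: C) t = ((\dim W == t) + dimdist C t)%N.
Proof. by []. Qed.

Lemma dimdist_const k s t : (forall X, X \in s -> \dim X = k) ->
  dimdist s t = ((k == t) * size s)%N.
Proof.
move=> dims; rewrite /dimdist (@eq_in_count _ _ (fun=> k == t)).
  by case: (k == t); rewrite ?count_predT ?mul1n //
    (@eq_count _ _ pred0) ?count_pred0.
by move=> X /dims ->.
Qed.

Lemma dimdist_gt C t : (v < t)%N -> dimdist C t = 0%N.
Proof.
move=> lt_vt; rewrite /dimdist; apply/eqP; rewrite -leqn0 leqNgt -has_count.
by apply/hasPn=> X _; apply: contraL lt_vt => /eqP<-; rewrite -leqNgt dim_subsp_le.
Qed.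

(** [U] and [X] are complementary, so [W + X] is the whole space and the dimension formula
    concludes. *)
Lemma super_cap_dim U W X : (U <= W)%VS -> \dim W = (\dim U).+1 ->
  (\dim U + \dim X = v)%N -> (U :&: X = 0)%VS -> \dim (W :&: X) = 1%N.
Proof.
move=> sUW dimW dUX djUX.
have le_v : (v <= \dim (W + X))%N.
  by rewrite -[leqLHS]dUX -dimv_disjoint_sum // dimvS // addvS.
by have := dimv_sum_cap W X; have := dim_subsp_le (W + X)%VS; dlia.
Qed.

Definition code_realizes d (dist : nat -> nat) C :=
  is_code d C /\ forall t, dimdist C t = dist t.

Lemma code_realizes_dual d dist C : code_realizes d dist C ->
  code_realizes d (fun t => if (t <= v)%N then dist (v - t)%N else 0%N)
    [seq dual X | X <- C].
Proof.
move=> [codeC distC]; split; first exact: dual_code.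
by move=> t; case: leqP => [le_tv | /dimdist_gt->]; rewrite ?dimdist_dual ?distC.
Qed.

(* A partial spread of [k]-spaces disjoint from an [N]-space [U], with [v = k +
   N], together with a subspace or a superspace [W] of [U]. *)
Lemma spread_code_exists d k N w : v = (k + N)%N -> (0 < k)%N -> (k <= N)%N ->
    (0 < w <= N.+1)%N -> (0 < d <= k.*2)%N ->
    (d <= if (w <= N)%N then k + w else k + N - 1)%N ->
  exists2 C, size C = (#|F| ^ N).+1 &
    code_realizes d (fun t => (w == t) + (k == t) * #|F| ^ N)%N C.
Proof.
move=> Dv k_gt0 le_kN /andP[w_gt0 le_wN] /andP[d_gt0 le_d2k] le_d.
have [U [s [dimU us sz_s [sU djs]]]] := partial_spread_exists F Dv k_gt0 le_kN.
have dims X : X \in s -> \dim X = k by case/sU.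
have [W dimW dW] : exists2 W, \dim W = w &
    forall X, X \in s -> (d <= subspace_dist W X)%N.
  (* A subspace of [U] still meets the members trivially, so the distance is [k + w]. A superspace,
     of dimension [N + 1], meets each of them in a line, which costs [2]. *)
  move: le_d; case: (leqP w N) => [le_w le_d | lt_w le_d].
    have [|W sWU dimW] := @sub_subspace_exists U w; first by rewrite dimU.
    exists W => // X sX; have [dimX djX] := sU X sX.
    have := subspace_distE W X; have -> : (W :&: X = 0)%VS.
      by apply/eqP; rewrite -subv0 -djX capvC capvS.
    by rewrite dimv0 dimW dimX; dlia.
  have [|W sUW dimW] := @super_subspace_exists U w; first by rewrite dimU Dv; lia.
  exists W => // X sX; have [dimX djX] := sU X sX.
  have := subspace_distE W X; rewrite (super_cap_dim sUW) ?dimW ?dimX ?dimU ?Dv //.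
  - by lia.
  - by lia.
  - by lia.
  - by rewrite capvC.
exists (W :: s); first by rewrite /= sz_s.
split=> [|t]; last by rewrite dimdist_cons (dimdist_const t dims) dimW sz_s.
by apply: code_cons => //; apply: code_le le_d2k _; apply: code_disjoint.
Qed.

(* Beside the superspace [W] of [U], one further member [X] is shrunk to a
   complement of [W :&: X] in [X], so as to be disjoint from [W]. *)
Lemma spread_code2_exists k : v = (2 * k)%N -> (2 <= k)%N ->
  exists2 C, size C = (#|F| ^ k).+1 &
    code_realizes (2 * k).-1
      (fun t => (k.+1 == t) + ((k.-1 == t) + (k == t) * (#|F| ^ k).-1))%N C.
Proof.
move=> Dv le2k; have Dv' : v = (k + k)%N by lia.
have [U [s [dimU us sz_s [sU djs]]]] :=
  partial_spread_exists F Dv' (ltnW le2k) (leqnn k).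
have [|W sUW dimW] := @super_subspace_exists U k.+1; first by rewrite dimU Dv; lia.
have qk_gt0 : (0 < #|F| ^ k)%N by rewrite expn_gt0 (ltnW (finNzRing_gt1 F)).
have [X0 sX0] : exists X0, X0 \in s.
  by case: s sz_s {us sU djs} => [|X s] sz;
    [move: qk_gt0; rewrite -sz | exists X; rewrite mem_head].
have capW X : X \in s -> \dim (W :&: X) = 1%N.
  move=> sX; have [dimX djX] := sU X sX.
  by apply: super_cap_dim sUW _ _ _; rewrite ?dimW ?dimU ?dimX ?Dv' // capvC.
pose Y := (X0 :\: W)%VS; have [dimX0 _] := sU _ sX0.
have dimY : \dim Y = k.-1.
  have := dimv_cap_compl X0 W; rewrite capvC capW // dimX0 -/Y; dlia.
have s'P X : X \in rem X0 s -> [/\ X \in s, \dim X = k & (Y :&: X = 0)%VS].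
  rewrite mem_rem_uniq // inE => /andP[neX sX]; split=> //.
    by case: (sU _ sX).
  by apply/eqP; rewrite -subv0 -(djs X X0) // capvC capvS ?diffvSl.
exists [:: W, Y & rem X0 s].
  by rewrite /= size_rem // sz_s prednK.
split=> [|t]; last first.
  by rewrite !dimdist_cons (@dimdist_const k) ?size_rem ?sz_s ?dimW ?dimY //
    => X /s'P[].
(* The distances are [2k] inside the remaining spread and between [W] and [Y], and [2k - 1] from
   either of these to the remaining members. *)
apply: code_cons; first by lia.
  apply: code_cons; first by lia.
    apply: (@code_le k.*2); first by lia.
    apply: code_disjoint; first exact: rem_uniq.
      by move=> X /s'P[].
    by move=> X X' /s'P[sX _ _] /s'P[sX' _ _]; apply: djs.
  move=> X /s'P[_ dimX djX].
  by have := subspace_distE Y X; rewrite djX dimv0 dimY dimX; dlia.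
move=> X; rewrite inE => /predU1P[-> | /s'P[sX dimX _]].
  have := subspace_distE W Y; rewrite capvC capv_diff dimv0 dimY dimW; dlia.
by have := subspace_distE W X; rewrite capW // dimW dimX; dlia.
Qed.

End Constructions.

(** * Packing bounds and averaging over hyperplanes *)

Section Packing.
Local Open Scope nat_scope.
Variables (F : finFieldType) (v : nat).
Implicit Types (X Y W : subsp F v) (s P R : seq (subsp F v)).
Local Notation q := #|F|.

Lemma count_le1 (T : eqType) (p : pred T) (s : seq T) : uniq s ->
  {in s &, forall x y, p x -> p y -> x = y} -> count p s <= 1.
Proof.
move=> us inj; rewrite -size_filter.
have := filter_uniq p us; have := mem_filter p^~ s.
case E: (filter p s) => [|x [|y t]] // _ /andP[].
have [px sx] : p x /\ x \in s.
  by apply/andP; rewrite -mem_filter E mem_head.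
have [py sy] : p y /\ y \in s.
  by apply/andP; rewrite -mem_filter E !inE eqxx orbT.
by rewrite (inj x y) // mem_head.
Qed.

Lemma sum_const_seq (T : eqType) (s : seq T) (f : T -> nat) (c : nat) :
  {in s, forall x, f x = c} -> \sum_(x <- s) f x = size s * c.
Proof.
move=> fc; rewrite big_seq (eq_bigr (fun=> c)); last by move=> x /fc.
by rewrite -big_seq big_const_seq count_predT iter_addn_0 mulnC.
Qed.

Definition disjoint_family s :=
  uniq s /\ forall X Y, X \in s -> Y \in s -> X != Y -> (X :&: Y = 0)%VS.

Lemma disjoint_count_le1 s (x : 'rV[F]_v) : disjoint_family s ->
  x != 0%R -> count (fun X : subsp F v => x \in X) s <= 1.
Proof.
move=> [us djs] nz_x; apply: count_le1 => // X Y sX sY Xx Yx.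
apply: contraNeq nz_x => /(djs _ _ sX sY) XY0.
by rewrite -memv0 -XY0 memv_cap Xx.
Qed.

(** Every vector of [T] is nonzero, hence in at most one member. *)
Lemma packing s (T : {set 'rV[F]_v}) : disjoint_family s -> 0%R \notin T ->
  \sum_(X <- s) #|T :&: [set x in X]| <= #|T|.
Proof.
move=> djs T0; rewrite -sum_count_card -sum1_card; apply: leq_sum => x Tx.
by apply: disjoint_count_le1 => //; apply: contraNneq T0 => <-.
Qed.

Lemma packing_in s W : disjoint_family s ->
  \sum_(X <- s) (q ^ \dim (W :&: X)).-1 <= (q ^ \dim W).-1.
Proof.
move=> djs; have := @packing s (nz_set W) djs; rewrite !inE eqxx => /(_ isT).
by under eq_bigr do rewrite nz_setI card_nz_set; rewrite card_nz_set.
Qed.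

Lemma packing_out s W : disjoint_family s ->
  \sum_(X <- s) (q ^ \dim X - q ^ \dim (W :&: X)) <= q ^ v - q ^ \dim W.
Proof.
move=> djs; have := @packing s (~: [set x in W]) djs.
have -> : #|~: [set x in W]| = q ^ v - q ^ \dim W.
  by rewrite cardsCs setCK card_set_subsp card_mx mul1n.
rewrite !inE mem0v => /(_ isT); apply: leq_trans; apply: leq_sum => X _.
have := cardsID [set x in W] [set x in X]; rewrite card_set_subsp => <-.
have -> : [set x in X] :&: [set x in W] = [set x in (W :&: X)%VS].
  by apply/setP=> x; rewrite !inE memv_cap andbC.
by rewrite card_set_subsp addKn setDE setIC.
Qed.

Lemma packing_out_const s k i W : disjoint_family s ->
    (forall X, X \in s -> \dim X = k /\ \dim (W :&: X) = i) ->
  size s * (q ^ k - q ^ i) <= q ^ v - q ^ \dim W.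
Proof.
move=> djs dims; apply: leq_trans (packing_out W djs).
by rewrite -(@sum_const_seq _ s (fun X => q ^ \dim X - q ^ \dim (W :&: X)))
  // => X /dims[-> ->].
Qed.

Lemma vspread_packing s k : disjoint_family s ->
  (forall X, X \in s -> \dim X = k) -> size s * (q ^ k - 1) <= q ^ v - 1.
Proof.
move=> djs dims; have := @packing_out_const s k 0 0%VS djs.
by rewrite dimv0 expn0; apply=> X /dims; rewrite cap0v dimv0.
Qed.

(** The hyperplane orthogonal to [w] contains [X] exactly when [w] is in [dual X]; otherwise it cuts
    one dimension. *)
Lemma cap_hyperplane_dim X (w : 'rV[F]_v) : w != 0%R ->
  \dim X <= \dim (dual <[w]> :&: X) + ~~ (w \in dual X).
Proof.
move=> nz_w; have dim_w : \dim <[w]> = 1 by rewrite dim_vline nz_w.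
have [Xw | _] := boolP (w \in dual X).
  rewrite addn0 dimvS // subv_cap subvv andbT dual_sub.
  by apply/subvP=> _ /vlineP[a ->]; rewrite memvZ.
have := dim_dual_cap <[w]> (dual X); rewrite dualK dim_w dim_dual.
have := dim_subsp_le X; dlia.
Qed.

(** [Q], [a], [n], [y] stand for [q], [q^(k-1)], the size of the spread and the number of members in
    a hyperplane. At the least values [n = Q^2 a + 2] and [y = Q + 1] the left side is already
    [Q^2 a^2 + a - 2]. *)
Lemma spread_arith1 (Q a n y : nat) : 1 < Q -> 1 < a ->
  (Q * (Q * a)).+1 < n -> Q < y ->
  n * (a - 1) + y * (Q * a - a) <= (Q * a * (Q * a)).-1 -> False.
Proof.
case: Q => [|Q] // Q_gt0; case: a => [|a] // a_gt0 lt_n lt_y.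
have -> : a.+1 - 1 = a by lia.
have -> : Q.+1 * a.+1 - a.+1 = Q * a.+1 by lia.
have := leq_mul lt_n (leqnn a); have := leq_mul lt_y (leqnn (Q * a.+1)).
nia.
Qed.

(** With [b = Q^2 a], the right side is [b^2 - Q], while [n >= b + 2] makes the left side at least
    [b^2 + b - 2]. *)
Lemma spread_arith2 (Q a n : nat) : 1 < Q -> 0 < a ->
  (Q * (Q * a)).+1 < n ->
  n * (Q * (Q * a) - 1) <= (Q * (Q * a * (Q * a)) - 1) * Q -> False.
Proof.
move=> Q_gt1 a_gt0 lt_n.
have -> : (Q * (Q * a * (Q * a)) - 1) * Q = Q * (Q * a) * (Q * (Q * a)) - Q.
  by rewrite mulnBl mul1n; congr (_ - _); lia.
have : Q * 2 <= Q * (Q * a) by rewrite leq_mul2l; nia.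
move: (Q * (Q * a)) lt_n => b lt_n le_b.
have := leq_mul lt_n (leqnn (b - 1)); nia.
Qed.

(* Averages over the hyperplanes [dual <[w]>]: one containing [q + 1] of the
   [k]-spaces would leave too little room for the traces of the others. *)
Lemma partial_spread_le s k : v = k.*2.+1 -> 1 < k -> disjoint_family s ->
  (forall X, X \in s -> \dim X = k) -> size s <= (q ^ k.+1).+1.
Proof.
move=> Dv k_gt1 djs dims; set n := size s; rewrite leqNgt; apply/negP=> lt_n.
have q_gt1 := finNzRing_gt1 F; have Dv1 : v - 1 = k.*2 by rewrite Dv subn1.
(* For nonzero [w], the number of members inside the hyperplane orthogonal to [w]. *)
pose x (w : 'rV[F]_v) := count (fun Y : subsp F v => w \in Y) [seq dual X | X <- s].
have k_gt0 := ltnW k_gt1; have a_gt1 : 1 < q ^ k.-1.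
  by rewrite -(expn0 q) ltn_exp2l // -ltnS prednK.
have Dk : q ^ k = q * q ^ k.-1 by rewrite -expnS prednK.
have Dk1 : q ^ k.+1 = q * (q * q ^ k.-1) by rewrite expnS Dk.
have D2k : q ^ k.*2 = (q * q ^ k.-1) * (q * q ^ k.-1).
  by rewrite -addnn expnD Dk.
have x_le (w : 'rV[F]_v) : w \in nz_set fullv -> x w <= q.
  rewrite !inE memvf andbT => nz_w.
  have := packing_in (dual <[w]>) djs.
  rewrite dim_dual dim_vline nz_w Dv1 => le_s.
  have {le_s} : n * (q ^ k.-1 - 1) + x w * (q ^ k - q ^ k.-1) <= (q ^ k.*2).-1.
    apply: leq_trans le_s; rewrite /x count_map -sum1_count big_mkcond /=.
    rewrite -(@sum_const_seq _ s (fun=> q ^ k.-1 - 1)) // big_distrl -big_split.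
    rewrite big_seq [leqRHS]big_seq leq_sum //= => X sX.
    have := cap_hyperplane_dim X nz_w; rewrite (dims X sX).
    case: (w \in dual X) => /=; rewrite ?addn0 ?addn1 => le_k.
      have := leq_pexp2l (ltnW q_gt1) le_k.
      have := leq_pexp2l (ltnW q_gt1) (leq_pred k).
      by move: (q ^ \dim _) (q ^ k) (q ^ k.-1) a_gt1 => c b a; lia.
    have /(leq_pexp2l (ltnW q_gt1)) : k.-1 <= \dim (dual <[w]> :&: X) by dlia.
    by move: (q ^ \dim _) (q ^ k.-1) => c a; lia.
  rewrite Dk D2k; move: lt_n; rewrite Dk1; move: (x w) => y.
  move: (q ^ k.-1) a_gt1 => a a_gt1 lt_n le_n; rewrite leqNgt; apply/negP=> lt_y.
  exact: spread_arith1 q_gt1 a_gt1 lt_n lt_y le_n.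
(* Each member lies in the hyperplanes of the [q^(k+1) - 1] nonzero vectors of its dual; summing
   [x w <= q] over all nonzero [w] bounds these incidences. *)
have : n * (q ^ k.+1 - 1) <= (q ^ v - 1) * q.
  have <- : #|nz_set (fullv : subsp F v)| = q ^ v - 1.
    by rewrite card_nz_set dim_fullrV subn1.
  rewrite -sum_nat_const.
  apply: (@leq_trans (\sum_(w in nz_set fullv) x w)); last exact: leq_sum.
  rewrite sum_count_card big_map.
  rewrite -(@sum_const_seq _ s (fun X => #|nz_set fullv :&: [set y in dual X]|)) //.
  move=> X sX; rewrite nz_setI card_nz_set.
  have -> : (fullv :&: dual X)%VS = dual X.
    by apply/vspaceP=> y; rewrite memv_cap memvf.
  by rewrite dim_dual dims // Dv subn1; congr (_ ^ _).-1; lia.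
have Dv' : q ^ v = q * ((q * q ^ k.-1) * (q * q ^ k.-1)).
  by rewrite Dv expnS D2k.
rewrite Dv' Dk1 => le_n; rewrite Dk1 in lt_n.
exact: spread_arith2 q_gt1 (ltnW a_gt1) lt_n le_n.
Qed.

(* With [r] and [x] the numbers of members of [R] and [P] through a nonzero
   vector, [x] is at most [1] and vanishes unless [r = 0]; so
   [(r - q) (r - q - 1) >= q (q + 1) x] throughout. *)
Lemma mixed_ineq P R k : v = k.*2.+1 ->
    disjoint_family P -> (forall X, X \in P -> \dim X = k) ->
    (forall X, X \in R -> \dim X = k.+1) ->
    (forall X Y, X \in P -> Y \in R -> (X :&: Y = 0)%VS) ->
    uniq R ->
    (forall X Y, X \in R -> Y \in R -> X != Y -> \dim (X :&: Y) = 1) ->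
  (q.*2 + 1) * (size R * (q ^ k.+1 - 1)) + q * (q + 1) * (size P * (q ^ k - 1))
  <= size R * (q ^ k.+1 - 1) + size R * (size R - 1) * (q - 1)
     + q * (q + 1) * (q ^ v - 1).
Proof.
move=> Dv djP dimP dimR djPR uR dimRR.
pose r (y : 'rV[F]_v) := count (fun Y : subsp F v => y \in Y) R.
pose x (y : 'rV[F]_v) := count (fun Y : subsp F v => y \in Y) P.
pose T : {set 'rV[F]_v} := nz_set fullv.
have capT X : T :&: [set y in X] = nz_set X.
  rewrite nz_setI; congr nz_set.
  by apply/vspaceP=> y; rewrite memv_cap memvf.
have sum_r : \sum_(y in T) r y = size R * (q ^ k.+1 - 1).
  rewrite sum_count_card; apply: sum_const_seq => X RX.
  by rewrite capT card_nz_set dimR ?subn1.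
have sum_x : \sum_(y in T) x y = size P * (q ^ k - 1).
  rewrite sum_count_card; apply: sum_const_seq => X PX.
  by rewrite capT card_nz_set dimP ?subn1.
(* Each ordered pair of distinct members shares the [q - 1] nonzero vectors of a line. *)
have sum_r2 : \sum_(y in T) r y * r y =
    size R * (q ^ k.+1 - 1) + size R * (size R - 1) * (q - 1).
  rewrite sum_count_weight -mulnA -mulnDr; apply: sum_const_seq => X RX.
  rewrite capT sum_count_card (bigD1_seq X) //=; congr (_ + _).
    by rewrite nz_setI capvv card_nz_set dimR ?subn1.
  have -> : size R - 1 = size (rem X R) by rewrite size_rem // subn1.
  rewrite -big_filter -rem_filter //.
  apply: sum_const_seq => Y; rewrite mem_rem_uniq // inE => /andP[neq RY].
  by rewrite nz_setI card_nz_set dimRR 1?eq_sym // expn1 subn1.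
have -> : q ^ v - 1 = #|T| by rewrite card_nz_set dim_fullrV subn1.
rewrite -sum_r2 -sum_r -sum_x -[q * (q + 1) * #|T|]mulnC -sum_nat_const.
rewrite !big_distrr /= -!big_split /=; apply: leq_sum => y.
rewrite !inE memvf andbT => nz_y.
have x_le1 : x y <= 1 by apply: disjoint_count_le1.
have [r0 | r_gt0] := posnP (r y); first by rewrite r0; nia.
have -> : x y = 0.
  apply/eqP; rewrite -leqn0 leqNgt -has_count; apply/hasP=> -[X PX Xy].
  have /hasP[Y RY Yy] : has (fun Y : subsp F v => y \in Y) R by rewrite has_count.
  by move: nz_y; rewrite -memv0 -(djPR X Y) // memv_cap Xy Yy.
move: (r y) (q) => a b; rewrite muln0 addn0.
(* What remains is [(a - b)(a - b - 1) >= 0], true for integers; the cases avoid truncated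
   subtraction. *)
have [/subnK<- | /ltnW/subnK<-] := leqP a b; first by move: (b - a) => c; nia.
by move: (a - b) => [|c]; nia.
Qed.

End Packing.

(** * Dimension layers of a code, and two adjacent layers in odd dimension *)

Section Classification.
Local Open Scope nat_scope.
Variables (F : finFieldType) (v : nat).
Implicit Types (X Y Z W : subsp F v) (C : seq (subsp F v)).
Local Notation q := #|F|.

(** The left bound is the distance and the right one is [\dim (X + Y) <= v], both in linear form for
    [lia]. *)
Lemma code_pair d C X Y : is_code d C -> X \in C -> Y \in C -> X != Y ->
  d + (\dim (X :&: Y)).*2 <= \dim X + \dim Y <= v + \dim (X :&: Y).
Proof.
move=> [_ dC] CX CY /(dC _ _ CX CY) le_d; have := subspace_distE X Y.
by have := dimv_sum_cap X Y; have := dim_subsp_le (X + Y)%VS; dlia.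
Qed.

(** One pair of codewords controls only the sum of two dimensions; the three pairs among three
    codewords control each dimension. *)
Lemma exists_third C X Y : uniq C -> 2 < size C ->
  exists Z, [/\ Z \in C, Z != X & Z != Y].
Proof.
move=> uC ltC; have /hasP[Z CZ] : has (fun Z => Z \notin [:: X; Y]) C.
  rewrite -[has _ _]negbK -all_predC; apply: contraL ltC => /allP sub_C.
  rewrite -leqNgt (@uniq_leq_size _ C [:: X; Y]) // => Z /sub_C /=.
  by rewrite negbK.
by rewrite !inE negb_or => /andP[neX neY]; exists Z.
Qed.

Lemma size_dimdist C (ts : seq nat) : uniq ts ->
  {in C, forall X, \dim X \in ts} -> size C = \sum_(t <- ts) dimdist C t.
Proof.
move=> uts; elim: C => [|X C IHC] dims; first by rewrite big1.
rewrite /= IHC => [|Y CY]; last by apply: dims; rewrite inE CY orbT.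
rewrite big_split /= -add1n; congr (_ + _).
have tsX : \dim X \in ts by apply: dims; rewrite mem_head.
by rewrite (bigD1_seq (\dim X)) //= eqxx big1 // => t; rewrite eq_sym => /negPf->.
Qed.

Lemma dimdist_eq0 C t : {in C, forall X, \dim X != t} -> dimdist C t = 0.
Proof.
move=> dims; apply/eqP; rewrite -leqn0 leqNgt -has_count.
by apply/hasPn=> X /dims.
Qed.

Lemma dimdist_le1 C t : uniq C ->
  (forall X Y, X \in C -> Y \in C -> \dim X = t -> \dim Y = t -> X = Y) ->
  dimdist C t <= 1.
Proof.
by move=> uC inj; apply: count_le1 => // X Y CX CY /eqP dX /eqP dY; apply: inj.
Qed.

Lemma dimdist_gt0 C t : 0 < dimdist C t -> exists2 X, X \in C & \dim X = t.
Proof. by rewrite -has_count => /hasP[X CX /eqP dX]; exists X. Qed.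

Lemma dimdist_rem C X t : X \in C ->
  dimdist C t = (\dim X == t) + dimdist (rem X C) t.
Proof. by move=> CX; rewrite /dimdist (seq.permP (perm_to_rem CX)). Qed.

Definition layer C t := [seq X <- C | \dim X == t].

Lemma mem_layer C t X : X \in layer C t -> X \in C /\ \dim X = t.
Proof. by rewrite mem_filter => /andP[/eqP]. Qed.

Lemma size_layer C t : size (layer C t) = dimdist C t.
Proof. by rewrite size_filter. Qed.

Lemma layer_disjoint d C k : is_code d C -> k.*2 < d.+2 -> disjoint_family (layer C k).
Proof.
move=> codeC lt_kd; split=> [|X Y /mem_layer[CX dX] /mem_layer[CY dY] neq].
  by case: codeC => uC _; apply: filter_uniq.
by apply/eqP; rewrite -dimv_eq0; have := code_pair codeC CX CY neq; dlia.
Qed.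

(* Here [p.+1] is the field order, and [i], [j] and [e] stand for
   [m - p.+1 - 1], [Q - m] and [n + m - Q - 1]. *)
Lemma mixed_arith (p i j e n m Q : nat) : 
  Q = p.+1 + 1 + i + j -> m = p.+1 + 1 + i -> n + m = Q + 1 + e ->
  (p.+1.*2 + 1) * (m * (Q - 1)) + (p.+1 + 1) * (n * (Q - p.+1))
    <= m * (Q - 1) + m * (m - 1) * (p.+1 - 1) + (p.+1 + 1) * (Q * Q - p.+1) ->
  p * i * j + e * (p + 2) * (i + j + 1) = 0.
Proof.
move=> DQ Dm Dn.
have -> : Q - 1 = p + 1 + i + j by lia.
have -> : Q - p.+1 = i + j + 1 by lia.
have -> : m - 1 = p + 1 + i by lia.
have -> : p.+1 - 1 = p by lia.
have {Dn} -> : n = e + j + 1 by lia.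
rewrite mulnBr {}DQ {}Dm; nia.
Qed.

(** The quadratic count becomes, by [mixed_arith], a vanishing sum of nonnegative terms: the excess
    is zero and [m] is at an end of its range. *)
Lemma mixed_bound C k : v = k.*2.+1 -> 0 < k -> is_code k.*2 C ->
  let n := dimdist C k in let m := dimdist C k.+1 in
  q ^ k.+1 + 1 <= n + m -> q + 1 <= m <= q ^ k.+1 ->
  n + m = q ^ k.+1 + 1 /\ (m = q + 1 \/ m = q ^ k.+1).
Proof.
move=> Dv k_gt0 codeC n m le_nm /andP[le_m ge_m]; have [uC _] := codeC.
have q_gt1 := finNzRing_gt1 F.
have djP : disjoint_family (layer C k) by apply: layer_disjoint codeC _; lia.
have := @mixed_ineq F v (layer C k) (layer C k.+1) k Dv djP.
rewrite !size_layer -/n -/m => /(_ _ _ _ (filter_uniq _ uC)) le_s.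
have {le_s} : (q.*2 + 1) * (m * (q ^ k.+1 - 1)) + q * (q + 1) * (n * (q ^ k - 1)) <=
     m * (q ^ k.+1 - 1) + m * (m - 1) * (q - 1) + q * (q + 1) * (q ^ v - 1).
  apply: le_s => [X /mem_layer[] // | X /mem_layer[] // | |].
    move=> X Y /mem_layer[CX dX] /mem_layer[CY dY].
    have neq : X != Y by apply/eqP=> eqXY; move: dX; rewrite eqXY dY; lia.
    by apply/eqP; rewrite -dimv_eq0; have := code_pair codeC CX CY neq; dlia.
  move=> X Y /mem_layer[CX dX] /mem_layer[CY dY] neq.
  by have := code_pair codeC CX CY neq; dlia.
(* Multiplying by [q] turns [q^v] and [q^k] into [Q^2] and [Q], where [Q = q^(k+1)]. *)
have Dqv : q * (q ^ v - 1) = q ^ k.+1 * q ^ k.+1 - q.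
  by rewrite mulnBr muln1 -expnS -expnD Dv; congr (_ ^ _ - _); lia.
have Dqk : q * (q ^ k - 1) = q ^ k.+1 - q by rewrite mulnBr muln1 -expnS.
have -> : q * (q + 1) * (n * (q ^ k - 1)) = (q + 1) * (n * (q ^ k.+1 - q)).
  by rewrite -Dqk; nia.
have -> : q * (q + 1) * (q ^ v - 1) = (q + 1) * (q ^ k.+1 * q ^ k.+1 - q).
  by rewrite -Dqv; nia.
move: (q ^ k.+1) le_nm ge_m => Q le_nm ge_m.
have [p Dp] : exists p, q = p.+1 by exists q.-1; rewrite prednK // ltnW.
rewrite Dp in le_m q_gt1 *.
move/(@mixed_arith p (m - p.+1 - 1) (Q - m) (n + m - Q - 1)) => E.
have {E} /eqP : p * (m - p.+1 - 1) * (Q - m)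
      + (n + m - Q - 1) * (p + 2) * (m - p.+1 - 1 + (Q - m) + 1) = 0.
  by apply: E; lia.
rewrite addn_eq0 !muln_eq0 => /andP[E1 E2]; lia.
Qed.

(** Duality exchanges [n] and [m], so every bound holds for both, and the rest is linear
    arithmetic. *)
Lemma odd_two_layers C k : v = k.*2.+1 -> 1 < k -> is_code k.*2 C ->
  let n := dimdist C k in let m := dimdist C k.+1 in
  n + m <= q ^ k.+1 + 1 /\ (n + m = q ^ k.+1 + 1 ->
    [\/ n = q ^ k.+1 + 1, m = q ^ k.+1 + 1, n = 1 | m = 1]).
Proof.
move=> Dv k_gt1; have q_gt1 := finNzRing_gt1 F.
(* This excludes the end value [q + 1] of [mixed_bound]: the other layer would have size [Q - q],
   strictly between its own two admissible values. *)
have le4q : 4 * q <= q ^ k.+1.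
  rewrite expnSr leq_mul2r; apply/orP; right.
  by apply: (@leq_trans (q ^ 2)); [rewrite (@leq_exp2r 2 q 2) | rewrite leq_exp2l].
have half (D : seq (subsp F v)) : is_code k.*2 D -> dimdist D k <= q ^ k.+1 + 1 /\
    (0 < dimdist D k.+1 -> dimdist D k <= q ^ k.+1).
  move=> codeD.
  have djP : disjoint_family (layer D k) by apply: layer_disjoint codeD _; lia.
  split.
    rewrite -size_layer addn1; apply: partial_spread_le Dv k_gt1 djP _.
    by move=> X /mem_layer[].
  (* The [k]-spaces of [D] all avoid [W], and outside it there is room for only [q^(k+1)] of
     them. *)
  move=> /dimdist_gt0[W DW dimW].
  have := @packing_out_const F v (layer D k) k 0 W djP.
  have a_gt1 : 1 < q ^ k by rewrite -(expn0 q) ltn_exp2l // ltnW.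
  have -> : q ^ v - q ^ \dim W = q ^ k.+1 * (q ^ k - 1).
    by rewrite mulnBr muln1 -expnD dimW Dv; congr (_ ^ _ - _); lia.
  rewrite expn0 leq_pmul2r ?subn_gt0 // size_layer; apply=> X /mem_layer[DX dimX].
  split=> //; have neq : W != X by apply/eqP=> E; move: dimX; rewrite -E dimW; lia.
  have := code_pair codeD DW DX neq; dlia.
move=> codeC n m; have codeD := dual_code codeC.
have := half _ codeC; have := half _ codeD.
have := mixed_bound Dv (ltnW k_gt1) codeC.
have := mixed_bound Dv (ltnW k_gt1) codeD.
have le_kv : k <= v by lia. have le_k1v : k.+1 <= v by lia.
have Dk : v - k = k.+1 by lia. have Dk1 : v - k.+1 = k by lia.
rewrite !dimdist_dual // Dk Dk1 -/n -/m.
move: (q ^ k.+1) le4q => Q le4q H1 H2 [H3 H4] [H5 H6].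
have H : n + m <= Q + 1.
  rewrite leqNgt; apply/negP=> lt_nm; clear -H1 H2 H3 H4 H5 H6 lt_nm le4q q_gt1.
  move: (q) n m q_gt1 le4q H1 H2 H3 H4 H5 H6 lt_nm => b n m *; lia.
split=> // Dnm.
have : n = Q + 1 \/ m = Q + 1 \/ n = 1 \/ m = 1.
  clear -H1 H2 H3 H4 H5 H6 Dnm le4q q_gt1.
  move: (q) n m q_gt1 le4q H1 H2 H3 H4 H5 H6 Dnm => b n m *; lia.
by case=> [|[|[|]]] ->; [apply: Or41 | apply: Or42 | apply: Or43 | apply: Or44].
Qed.

End Classification.

(** * Size bounds and dimension distributions of large codes *)

Section Extremal.
Local Open Scope nat_scope.
Variables (F : finFieldType) (v : nat).
Implicit Types (X Y Z W : subsp F v) (C : seq (subsp F v)).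
Local Notation q := #|F|.

(** Each outer layer has at most one codeword. Packing bounds the middle layer by [q^k + 1], by
    [q^k] beside one outer codeword, and by [q^k - 1] beside two. *)
Lemma even_code C k : v = k.*2 -> 1 < k -> is_code k.*2.-1 C -> 2 < size C ->
  size C <= (q ^ k).+1 /\ (size C = (q ^ k).+1 ->
    (dimdist C k.-1, dimdist C k, dimdist C k.+1) \in
      [:: (0, (q ^ k).+1, 0); (1, q ^ k, 0); (0, q ^ k, 1); (1, (q ^ k).-1, 1)]
    /\ (forall t, t != k.-1 -> t != k -> t != k.+1 -> dimdist C t = 0)).
Proof.
move=> Dv k_gt1 codeC ltC; have [uC _] := codeC; have q_gt1 := finNzRing_gt1 F.
have qk_gt1 : 1 < q ^ k by rewrite -(expn0 q) ltn_exp2l // ltnW.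
have dims : {in C, forall X, \dim X \in [:: k.-1; k; k.+1]}.
  move=> X CX; have [Y [CY neYX _]] := exists_third X X uC ltC.
  have [Z [CZ neZX neZY]] := exists_third X Y uC ltC.
  have := code_pair codeC CY CX neYX; have := code_pair codeC CZ CX neZX.
  have := code_pair codeC CZ CY neZY; rewrite !inE; dlia.
have le1 t : t != k -> dimdist C t <= 1.
  move=> ne_tk; apply: dimdist_le1 => // X Y CX CY dX dY.
  apply/eqP/contraT => neq; have := code_pair codeC CX CY neq.
  by have := dims X CX; rewrite !inE; dlia.
have Dqv : q ^ v = q ^ k * q ^ k by rewrite -expnD addnn Dv.
have dj_k : disjoint_family (layer C k) by apply: layer_disjoint codeC _; lia.
have sz_k : size (layer C k) = dimdist C k := size_layer C k.
(* Truncated subtraction covers both outer dimensions: [0] for [k.-1] and [1] for [k.+1]. *)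
have cap_k W : W \in C -> \dim W != k -> forall X, X \in layer C k ->
    \dim X = k /\ \dim (W :&: X) = \dim W - k.
  move=> CW dW X /mem_layer[CX dX]; split=> //.
  have neq : W != X by apply: contraNneq dW => ->; rewrite dX.
  by have := code_pair codeC CW CX neq; have := dims W CW; rewrite !inE; dlia.
have le_n : dimdist C k <= (q ^ k).+1.
  have := @vspread_packing F v _ k dj_k; rewrite sz_k Dqv => le_s.
  have {le_s} := le_s (fun X => @proj2 _ _ \o @mem_layer _ _ _ _ _).
  move: (q ^ k) qk_gt1 => Q Q_gt1.
  have -> : Q * Q - 1 = Q.+1 * (Q - 1) by nia.
  by rewrite leq_pmul2r // subn_gt0.
have le_n1 : 0 < dimdist C k.-1 -> dimdist C k <= q ^ k.
  move=> /dimdist_gt0[W CW dW].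
  have := packing_out_const dj_k (cap_k W CW _); rewrite dW sz_k Dqv.
  have -> : k.-1 - k = 0 by lia.
  have ltq : 1 < q ^ k.-1 by rewrite -(expn0 q) ltn_exp2l //; lia.
  have ne_k : k.-1 != k by lia.
  move=> /(_ ne_k); rewrite expn0.
  by move: (q ^ k) (q ^ k.-1) qk_gt1 ltq => Q a; nia.
have Dk1 : q ^ v - q ^ k.+1 = q ^ k * (q ^ k - q).
  by rewrite Dqv expnSr mulnBr.
have ltqk : q < q ^ k by rewrite -[X in X < _]expn1 ltn_exp2l.
have ne_k1 : k.+1 != k by lia.
have Dk11 : k.+1 - k = 1 by lia.
have le_n2 : 0 < dimdist C k.+1 -> dimdist C k <= q ^ k.
  move=> /dimdist_gt0[W CW dW].
  have := packing_out_const dj_k (cap_k W CW _).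
  rewrite dW sz_k Dk11 expn1 Dk1 => /(_ ne_k1).
  by rewrite leq_pmul2r // subn_gt0.
have le_n3 : 0 < dimdist C k.-1 -> 0 < dimdist C k.+1 -> dimdist C k < q ^ k.
  move=> /dimdist_gt0[U CU dU] /dimdist_gt0[W CW dW].
  have ne_UW : W != U by apply/eqP=> E; move: dU; rewrite -E dW; lia.
  have capWU : \dim (W :&: U) = 0.
    have := code_pair codeC CW CU ne_UW; rewrite dW dU.
    clear -k_gt1; dlia.
  have neU X : X \in layer C k -> (U :&: X = 0)%VS.
    move=> /mem_layer[CX dX]; have neq : U != X.
      by apply/eqP=> E; move: dU; rewrite E dX; lia.
    by apply/eqP; rewrite -dimv_eq0; have := code_pair codeC CU CX neq; dlia.
  (* [U] joins the packing outside [W] and takes [q^(k-1) - 1] vectors, so [q^k] members of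
     dimension [k] no longer fit. *)
  have djU : disjoint_family (U :: layer C k).
    case: dj_k => uk djk; split=> [|X Y].
      rewrite cons_uniq uk andbT; apply/negP=> /mem_layer[_]; rewrite dU; lia.
    rewrite !inE => /predU1P[->|sX] /predU1P[->|sY]; rewrite ?eqxx // => neq.
    - exact: neU.
    - by rewrite capvC; apply: neU.
    exact: djk.
  have := packing_out W djU; rewrite big_cons capWU dU dW Dk1.
  rewrite (@sum_const_seq _ _ _ (q ^ k - q)); last first.
    move=> X sX; have [|-> ->] := cap_k W CW _ X sX; first by rewrite dW.
    by rewrite dW Dk11.
  have ltq : 1 < q ^ k.-1 by rewrite -(expn0 q) ltn_exp2l //; lia.
  rewrite sz_k expn0 => le_s; rewrite ltnNge; apply/negP=> le_qn.
  have : q ^ k * (q ^ k - q) <= dimdist C k * (q ^ k - q).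
    by rewrite leq_mul2r le_qn orbT.
  by move: le_s; move: (q ^ k * _) (dimdist C k * _) (q ^ k.-1) ltq => A B D; lia.
have szC : size C = dimdist C k.-1 + dimdist C k + dimdist C k.+1.
  rewrite (@size_dimdist _ _ C [:: k.-1; k; k.+1]) //.
    by rewrite !big_cons big_nil; lia.
  by rewrite /= !inE; lia.
have := le1 _ ne_k1; have := le1 k.-1; rewrite szC.
have ne_k2 : k.-1 != k by lia.
move=> /(_ ne_k2).
move: (dimdist C k.-1) (dimdist C k) (dimdist C k.+1) le_n le_n1 le_n2 le_n3.
move: (q ^ k) qk_gt1 => Q Q_gt1 a n c le_n le_n1 le_n2 le_n3 le_a le_c.
split; first by lia.
move=> Dsum; split; last first.
  move=> t t1 t2 t3; apply: dimdist_eq0 => X /dims; rewrite !inE; lia.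
by rewrite !inE !xpair_eqE; lia.
Qed.

(** All other codewords must have dimension [k]; they are pairwise disjoint and meet [W] in a line,
    so the packing outside [W] bounds their number. *)
Lemma odd_code_big C W k : v = k.*2.+1 -> 1 < k -> is_code k.*2 C ->
    2 < size C -> W \in C -> \dim W = k.+2 ->
  size C <= (q ^ k.+1).+1 /\
  forall t, dimdist C t = (k.+2 == t) + (k == t) * (size C).-1.
Proof.
move=> Dv k_gt1 codeC ltC CW dimW; have [uC _] := codeC.
have q_gt1 := finNzRing_gt1 F.
have inD X : X \in rem W C -> X \in C /\ X != W.
  by rewrite mem_rem_uniq // inE => /andP[].
have dims X : X \in rem W C -> \dim X = k.
  move=> /inD[CX neq]; have [Z [CZ neZX neZW]] := exists_third X W uC ltC.
  have := code_pair codeC CX CW neq; have := code_pair codeC CZ CW neZW.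
  have := code_pair codeC CZ CX neZX; dlia.
have szD : size (rem W C) = (size C).-1 by rewrite size_rem.
have djD : disjoint_family (rem W C).
  split=> [|X Y DX DY neq]; first exact: rem_uniq.
  have [CX _] := inD X DX; have [CY _] := inD Y DY.
  apply/eqP; rewrite -dimv_eq0; have := code_pair codeC CX CY neq.
  by rewrite (dims X) // (dims Y) //; dlia.
split=> [|t]; last by rewrite (dimdist_rem t CW) (dimdist_const t dims) dimW szD.
have := @packing_out_const F v _ k 1 W djD; rewrite szD dimW.
have -> : q ^ v - q ^ k.+2 = q ^ k.+1 * (q ^ k - q ^ 1).
  by rewrite mulnBr -!expnD Dv; congr (_ ^ _ - _ ^ _); lia.
have lt_q : q ^ 1 < q ^ k by rewrite ltn_exp2l.
rewrite leq_pmul2r ?subn_gt0 // => le_s.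
have : (size C).-1 <= q ^ k.+1; last by lia.
apply: le_s => X DX; split; first exact: dims.
have [CX neq] := inD X DX; have := code_pair codeC CX CW neq.
by rewrite capvC (dims X) //; dlia.
Qed.

(** A codeword of dimension [k + 2] is settled by [odd_code_big], one of dimension [k - 1] by
    passing to the dual code; otherwise only two layers remain. *)
Lemma odd_code C k : v = k.*2.+1 -> 1 < k -> is_code k.*2 C -> 2 < size C ->
  size C <= (q ^ k.+1).+1 /\ (size C = (q ^ k.+1).+1 ->
    (dimdist C k.-1, dimdist C k, dimdist C k.+1, dimdist C k.+2) \in
      [:: (0, (q ^ k.+1).+1, 0, 0); (0, 0, (q ^ k.+1).+1, 0);
          (0, q ^ k.+1, 1, 0); (0, 1, q ^ k.+1, 0);
          (0, q ^ k.+1, 0, 1); (1, 0, q ^ k.+1, 0)]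
    /\ (forall t, t != k.-1 -> t != k -> t != k.+1 -> t != k.+2 ->
          dimdist C t = 0)).
Proof.
move=> Dv k_gt1 codeC ltC; have [uC _] := codeC.
have dims4 X : X \in C -> \dim X \in [:: k.-1; k; k.+1; k.+2].
  move=> CX; have [Y [CY neYX _]] := exists_third X X uC ltC.
  have [Z [CZ neZX neZY]] := exists_third X Y uC ltC.
  have := code_pair codeC CY CX neYX; have := code_pair codeC CZ CX neZX.
  have := code_pair codeC CZ CY neZY; rewrite !inE; dlia.
have [/hasP[W CW /eqP dW] | no_big] := boolP (has (fun X => \dim X == k.+2) C).
  have [le_C dC] := odd_code_big Dv k_gt1 codeC ltC CW dW; split=> // szC.
  split=> [|t t1 t2 t3 t4]; last by rewrite dC; lia.
  have -> : dimdist C k.-1 = 0 by rewrite dC; lia.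
  have -> : dimdist C k = q ^ k.+1 by rewrite dC szC; lia.
  have -> : dimdist C k.+1 = 0 by rewrite dC; lia.
  have -> : dimdist C k.+2 = 1 by rewrite dC; lia.
  by rewrite !inE eqxx !orbT.
have [/hasP[W CW /eqP dW] | no_small] := boolP (has (fun X => \dim X == k.-1) C).
  have CW' : dual W \in [seq dual X | X <- C] by apply: map_f.
  have dW' : \dim (dual W) = k.+2 by rewrite dim_dual dW; lia.
  have [|le_C dC] := odd_code_big Dv k_gt1 (dual_code codeC) _ CW' dW'.
    by rewrite size_map.
  rewrite size_map in le_C dC.
  have {}dC t : dimdist C t = (k.-1 == t) + (k.+1 == t) * (size C).-1.
    have [le_tv | lt_vt] := leqP t v; last by rewrite dimdist_gt //; lia.
    rewrite -{1}[t](subKn le_tv) -dimdist_dual ?leq_subr // dC.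
    by congr (nat_of_bool _ + nat_of_bool _ * _); lia.
  split=> // szC.
  split=> [|t t1 t2 t3 t4]; last by rewrite dC; lia.
  have -> : dimdist C k.-1 = 1 by rewrite dC; lia.
  have -> : dimdist C k = 0 by rewrite dC; lia.
  have -> : dimdist C k.+1 = q ^ k.+1 by rewrite dC szC; lia.
  have -> : dimdist C k.+2 = 0 by rewrite dC; lia.
  by rewrite !inE eqxx !orbT.
have dims : {in C, forall X, \dim X \in [:: k; k.+1]}.
  move=> X CX; have := dims4 X CX; move/hasPn: no_big => /(_ X CX).
  by move/hasPn: no_small => /(_ X CX); rewrite !inE => /negPf-> /negPf->; rewrite orbF.
have szC : size C = dimdist C k + dimdist C k.+1.
  rewrite (@size_dimdist _ _ C [:: k; k.+1]) //.
    by rewrite !big_cons big_nil addn0.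
  by rewrite /= !inE; lia.
have [le_C exC] := odd_two_layers Dv k_gt1 codeC; rewrite szC.
split=> [|Dsum]; first by lia.
have eq0 t : t != k -> t != k.+1 -> dimdist C t = 0.
  by move=> t1 t2; apply: dimdist_eq0 => X /dims; rewrite !inE; lia.
split=> [|t _ t1 t2 _]; last exact: eq0.
rewrite (eq0 k.-1) ?(eq0 k.+2); try lia.
rewrite !inE !xpair_eqE; move: exC Dsum.
by move: (dimdist C k) (dimdist C k.+1) => n m exC Dsum; case: exC; lia.
Qed.

End Extremal.

(** * Codes for each listed distribution *)

Section Realization.
Local Open Scope nat_scope.
Variable F : finFieldType.
Local Notation q := #|F|.

Lemma code_realizes_cdc v d k (C : seq (subsp F v)) dist :
    code_realizes d dist C -> (forall t, t != k -> dist t = 0) ->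
  is_cdc d k C.
Proof.
move=> [codeC distC] dist0; split=> // X CX; apply/eqP/contraT => /dist0.
rewrite -distC => /eqP; rewrite -leqn0 leqNgt -has_count => /hasPn/(_ X CX).
by rewrite eqxx.
Qed.

(** In order: [U] kept, shrunk, enlarged, and enlarged with a second member shrunk. *)
Lemma even_realized k a b c : 2 <= k -> (a, b, c) \in
    [:: (0, (q ^ k).+1, 0); (1, q ^ k, 0); (0, q ^ k, 1); (1, (q ^ k).-1, 1)] ->
  exists C : seq (subsp F (2 * k)), is_code (2 * k).-1 C /\ size C = (q ^ k).+1 /\
    dimdist C k.-1 = a /\ dimdist C k = b /\ dimdist C k.+1 = c /\
    (forall t, t != k.-1 -> t != k -> t != k.+1 -> dimdist C t = 0).
Proof.
move=> k_gt1; have Dv : 2 * k = k + k by lia.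
have exC w : 0 < w <= k.+1 -> k.-1 <= w ->
    exists2 C : seq (subsp F (2 * k)), size C = (q ^ k).+1 & 
      code_realizes (2 * k).-1 (fun t => (w == t) + (k == t) * q ^ k) C.
  move=> le_w ge_w; apply: spread_code_exists => //; try lia.
  by case: (leqP w k); lia.
rewrite !inE !xpair_eqE.
case/or4P=> /andP[/andP[/eqP-> /eqP->] /eqP->].
- have [||C szC [codeC dC]] := exC k; try lia; exists C.
  by do ![split=> //] => *; rewrite dC; lia.
- have [||C szC [codeC dC]] := exC k.-1; try lia; exists C.
  by do ![split=> //] => *; rewrite dC; lia.
- have [||C szC [codeC dC]] := exC k.+1; try lia; exists C.
  by do ![split=> //] => *; rewrite dC; lia.
have [C szC [codeC dC]] := spread_code2_exists F (erefl (2 * k)) k_gt1; exists C.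
by do ![split=> //] => *; rewrite dC; lia.
Qed.

(** Here [U] has dimension [k + 1] and is shrunk, kept or enlarged by one; the dual codes give the
    other three patterns. *)
Lemma odd_realized k a b c d : 2 <= k -> (a, b, c, d) \in
    [:: (0, (q ^ k.+1).+1, 0, 0); (0, 0, (q ^ k.+1).+1, 0);
        (0, q ^ k.+1, 1, 0); (0, 1, q ^ k.+1, 0);
        (0, q ^ k.+1, 0, 1); (1, 0, q ^ k.+1, 0)] ->
  exists C : seq (subsp F (2 * k).+1), is_code (2 * k) C /\
    size C = (q ^ k.+1).+1 /\
    dimdist C k.-1 = a /\ dimdist C k = b /\ dimdist C k.+1 = c /\
    dimdist C k.+2 = d /\
    (forall t, t != k.-1 -> t != k -> t != k.+1 -> t != k.+2 -> dimdist C t = 0).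
Proof.
move=> k_gt1; have Dv : (2 * k).+1 = k + k.+1 by lia.
have exC w : k <= w <= k.+2 ->
    exists2 C : seq (subsp F (2 * k).+1), size C = (q ^ k.+1).+1 & 
      code_realizes (2 * k) (fun t => (w == t) + (k == t) * q ^ k.+1) C.
  move=> le_w; apply: spread_code_exists => //; try lia.
  by case: (leqP w k.+1); lia.
have exC' w : k <= w <= k.+2 ->
    exists2 C : seq (subsp F (2 * k).+1), size C = (q ^ k.+1).+1 & 
      is_code (2 * k) C /\
      forall t, dimdist C t = ((k + k.+1 - w == t) + (k.+1 == t) * q ^ k.+1).
  move=> le_w; have [C szC /code_realizes_dual[codeC dC]] := exC w le_w.
  exists [seq dual X | X <- C]; first by rewrite size_map.
  split=> // t; rewrite dC; case: (leqP t) => lt_tv; last by lia.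
  by congr (nat_of_bool _ + nat_of_bool _ * _); lia.
rewrite !inE !xpair_eqE -!andbA.
case/or4P=> [||| /or3P[]] /and4P[/eqP-> /eqP-> /eqP-> /eqP->].
- have [|C szC [codeC dC]] := exC k; try lia; exists C.
  by do ![split=> //] => *; rewrite dC; lia.
- have [|C szC [codeC dC]] := exC' k; try lia; exists C.
  by do ![split=> //] => *; rewrite dC; lia.
- have [|C szC [codeC dC]] := exC k.+1; try lia; exists C.
  by do ![split=> //] => *; rewrite dC; lia.
- have [|C szC [codeC dC]] := exC' k.+1; try lia; exists C.
  by do ![split=> //] => *; rewrite dC; lia.
- have [|C szC [codeC dC]] := exC k.+2; try lia; exists C.
  by do ![split=> //] => *; rewrite dC; lia.
have [|C szC [codeC dC]] := exC' k.+2; try lia; exists C.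
by do ![split=> //] => *; rewrite dC; lia.
Qed.

End Realization.

Theorem mainTheorem10 (F : finFieldType) :
  (* (i) v = 2k >= 4 *)
  (forall k : nat, (2 <= k)%N ->
     let v := (2 * k)%N in
     let q := #|F| in
     isAq F v v.-1 (q ^ k).+1 /\ isAqk F v v k (q ^ k).+1 /\
     (forall C : seq (subsp F v), is_code v.-1 C -> size C = (q ^ k).+1 ->
        (dimdist C k.-1, dimdist C k, dimdist C k.+1) \in
          [:: (0, (q ^ k).+1, 0); (1, q ^ k, 0); (0, q ^ k, 1); (1, (q ^ k).-1, 1)]
        /\ (forall t, t != k.-1 -> t != k -> t != k.+1 -> dimdist C t = 0%N)) /\
     (forall a b c, (a, b, c) \in
          [:: (0, (q ^ k).+1, 0); (1, q ^ k, 0); (0, q ^ k, 1); (1, (q ^ k).-1, 1)] ->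
        exists C : seq (subsp F v), is_code v.-1 C /\ size C = (q ^ k).+1 /\
          dimdist C k.-1 = a /\ dimdist C k = b /\ dimdist C k.+1 = c /\
          (forall t, t != k.-1 -> t != k -> t != k.+1 -> dimdist C t = 0%N))) /\
  (* (ii) v = 2k+1 >= 5 *)
  (forall k : nat, (2 <= k)%N ->
     let v := (2 * k).+1 in
     let q := #|F| in
     let L := [:: (0, (q ^ k.+1).+1, 0, 0); (0, 0, (q ^ k.+1).+1, 0);
                  (0, q ^ k.+1, 1, 0); (0, 1, q ^ k.+1, 0);
                  (0, q ^ k.+1, 0, 1); (1, 0, q ^ k.+1, 0)] in
     isAq F v v.-1 (q ^ k.+1).+1 /\ isAqk F v v.-1 k (q ^ k.+1).+1 /\
     (forall C : seq (subsp F v), is_code v.-1 C -> size C = (q ^ k.+1).+1 ->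
        (dimdist C k.-1, dimdist C k, dimdist C k.+1, dimdist C k.+2) \in L
        /\ (forall t, t != k.-1 -> t != k -> t != k.+1 -> t != k.+2 ->
              dimdist C t = 0%N)) /\
     (forall a b c d, (a, b, c, d) \in L ->
        exists C : seq (subsp F v), is_code v.-1 C /\ size C = (q ^ k.+1).+1 /\
          dimdist C k.-1 = a /\ dimdist C k = b /\ dimdist C k.+1 = c /\
          dimdist C k.+2 = d /\
          (forall t, t != k.-1 -> t != k -> t != k.+1 -> t != k.+2 ->
              dimdist C t = 0%N))).
Proof.
have q_gt1 := finNzRing_gt1 F.
have qe_gt1 e : (0 < e)%N -> (1 < #|F| ^ e)%N.
  by move=> e_gt0; rewrite -(expn0 #|F|) ltn_exp2l.
split=> k k_gt1 v q.
  have Dv : v = k.*2 by rewrite /v mul2n.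
  (* [eq_rect] only rewrites [v] as [k.*2] inside the distance. *)
  have classify (C : seq (subsp F v)) : is_code v.-1 C -> (2 < size C)%N -> _ :=
    fun codeC => @even_code F v C k Dv k_gt1
      (eq_rect _ (fun d => is_code d.-1 C) codeC _ Dv).
  have le_size (C : seq (subsp F v)) : is_code v.-1 C -> (size C <= (q ^ k).+1)%N.
    move=> codeC; case: (ltnP 2 (size C)) => [lt_C | le_C].
      by case: (classify C codeC lt_C).
    (* Codes with at most two members escape the classification but lie below the bound. *)
    by apply: leq_trans le_C _; rewrite ltnS ltnW // qe_gt1 // ltnW.
  split; [split=> // | split; [split | split=> [C codeC szC | a b c]]].
  - have [|C [codeC [szC _]]] := @even_realized F k 0 (q ^ k).+1 0 k_gt1.
      by rewrite mem_head.
    by exists C.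
  - have [||||||C szC realC] := @spread_code_exists F v v k k k;
      try by rewrite ?leqnn; lia.
    exists C; split=> //; apply: code_realizes_cdc realC _ => t.
    by rewrite eq_sym => /negPf->.
  - by move=> C [codeC _]; apply: le_size; apply: code_le codeC; apply: leq_pred.
  - case: (classify C codeC); last by move=> _; apply.
    by rewrite szC ltnS qe_gt1 // ltnW.
  exact: even_realized.
have Dv : v = k.*2.+1 by rewrite /v mul2n.
have classify (C : seq (subsp F v)) : is_code v.-1 C -> (2 < size C)%N -> _ :=
  fun codeC => @odd_code F v C k Dv k_gt1
      (eq_rect _ (fun d => is_code d.-1 C) codeC _ Dv).
move=> L.
have le_size (C : seq (subsp F v)) : is_code v.-1 C ->
  (size C <= (q ^ k.+1).+1)%N.
  move=> codeC; case: (ltnP 2 (size C)) => [lt_C | le_C].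
    by case: (classify C codeC lt_C).
  by apply: leq_trans le_C _; rewrite ltnS ltnW // qe_gt1.
(* With [U] shrunk to dimension [k], this one code attains both maxima. *)
have [C0 szC0 realC0] : exists2 C : seq (subsp F v), size C = (q ^ k.+1).+1 &
    code_realizes v.-1 (fun t => (k == t) + (k == t) * q ^ k.+1)%N C.
  apply: spread_code_exists; rewrite /v; try lia.
  by case: (leqP k k.+1); lia.
split; [split=> // | split; [split | split=> [C codeC szC | a b c d]]].
- by exists C0; case: realC0.
- exists C0; split=> //; apply: code_realizes_cdc realC0 _ => t.
  by rewrite eq_sym => /negPf->.
- by move=> C [codeC _]; apply: le_size.
- case: (classify C codeC); last by move=> _; apply.
  by rewrite szC ltnS qe_gt1.
exact: odd_realized.
Qed.
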